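(* Let $G$ be a topological group and let $\alpha$ be a size of $G$. For each of the following properties, either every t.d.l.c. completion of $G$ of size $\alpha$ has the property, or every t.d.l.c. completion of $G$ of size $\alpha$ fails to have the property: (1) being $\sigma$-compact; (2) being compactly generated; (3) being amenable; (4) being uniscalar; (5) having a quotient isomorphic to $N$, where $N$ is any specified t.d.l.c. group that has no non-trivial compact normal subgroups.
   Context: Topological groups are Hausdorff. A t.d.l.c. group is a totally disconnected, locally compact (Hausdorff) topological group. A quotient of a topological group means the quotient by a closed normal subgroup, with the quotient topology; isomorphism is isomorphism of topological groups. A (t.d.l.c.) completion map is a continuous homomorphism $\phi:G\rightarrow H$ with dense image such that $H$ is a t.d.l.c. group; $H$ is then called a t.d.l.c. completion of $G$. Two subgroups $U,V$ of a group are commensurate if $U\cap V$ has finite index in both. A subgroup $W\le G$ is commensurated in $G$ if $W$ is commensurate with $gWg^{-1}$ for all $g\in G$. For $U\le G$, $[U]$ is the set of closed subgroups of $G$ commensurate with $U$; the collection $[U]$ is called a size of $G$ if some (equivalently, any) $W\in[U]$ is commensurated in $G$. If $\phi:G\rightarrow H$ is a completion map and $R$ is a compact open subgroup of $H$, then $\phi^{-1}(R)$ is an open commensurated subgroup of $G$, and the size of $\phi$ (or of $H$) is $[\phi^{-1}(R)]$, which does not depend on the choice of $R$. For a t.d.l.c. group $H$, the scale function is $s(g)=\min\{|gUg^{-1}:gUg^{-1}\cap U| \mid U \text{ a compact open subgroup of } H\}$. An element $g$ is uniscalar if $s(g)=s(g^{-1})=1$, and $H$ is uniscalar if all its elements are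 uniscalar. *)

(* Defs.v *)
From HB Require Import structures.
From mathcomp Require Import all_boot all_order all_algebra generic_quotient.
From mathcomp Require Import all_classical all_reals all_analysis.
Import numFieldNormedType.Exports.

Set Implicit Arguments.
Unset Strict Implicit.
Unset Printing Implicit Defensive.

Import Order.TTheory GRing.Theory Num.Theory.

Local Open Scope classical_set_scope.
Local Open Scope card_scope.
Local Open Scope group_scope.

(* The Hausdorff condition is not part of the structure: it is assumed
   separately, for the source of a completion and in [tdlc]. *)
HB.mixin Record isTopologicalGroup G of Group G & Topological G := {
  mulg_continuous : continuous (fun x : G * G => x.1 * x.2) ;
  invg_continuous : continuous (fun x : G => x^-1) }.

#[short(type="topGroupType")]
HB.structure Definition TopologicalGroup :=
  { G of isTopologicalGroup G & Group G & Topological G }.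

Section Subgroups.
Variable G : groupType.
Implicit Types U V W : set G.

Definition subgroup U : Prop :=
  [/\ U 1, forall x y, U x -> U y -> U (x * y) & forall x, U x -> U x^-1].

Definition conj_set (g : G) U : set G := [set g * u * g^-1 | u in U].

Definition normal_subgroup U : Prop :=
  subgroup U /\ forall g, conj_set g U = U.

Definition lcosets U V : set (set G) := [set [set x * v | v in V] | x in U].

Definition finite_index U V : Prop := finite_set (lcosets U V).

(* |U : V| = n; false for every n when the index is infinite *)
Definition has_index U V (n : nat) : Prop := lcosets U V #= `I_n.

Definition commensurate U V : Prop :=
  finite_index U (U `&` V) /\ finite_index V (U `&` V).

Definition commensurated W : Prop := forall g, commensurate W (conj_set g W).

End Subgroups.

Section Sizes.
Variable G : topGroupType.

(* the set [U] *)
Definition comm_class (U : set G) : set (set G) :=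
  [set W | [/\ subgroup W, closed W & commensurate U W]].

Definition is_size (alpha : set (set G)) : Prop :=
  exists U, [/\ subgroup U, alpha = comm_class U &
                exists2 W, alpha W & commensurated W].

Definition compact_open_subgroup (U : set G) : Prop :=
  [/\ subgroup U, compact U & open U].

End Sizes.

Definition tdlc (H : topGroupType) : Prop :=
  [/\ hausdorff_space H, totally_disconnected [set: H] &
      locally_compact [set: H]].

Section Completions.
Variable G : topGroupType.

Definition completion_map (H : topGroupType) (phi : G -> H) : Prop :=
  [/\ tdlc H, {morph phi : x y / x * y}, continuous phi & dense (range phi)].

Definition completion_size (H : topGroupType) (phi : G -> H)
    (alpha : set (set G)) : Prop :=
  exists2 V : set H, compact_open_subgroup V &
    alpha = comm_class (phi @^-1` V).

Definition tdlc_completion_of_size (alpha : set (set G)) (H : topGroupType) :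
    Prop :=
  exists2 phi : G -> H, completion_map phi & completion_size phi alpha.

Definition determined_by_size (alpha : set (set G))
    (P : topGroupType -> Prop) : Prop :=
  (forall H, tdlc_completion_of_size alpha H -> P H) \/
  (forall H, tdlc_completion_of_size alpha H -> ~ P H).

End Completions.

Definition sigma_compact (H : topGroupType) : Prop :=
  exists2 K : nat -> set H, (forall n, compact (K n)) &
    \bigcup_n K n = [set: H].

Definition compactly_generated (H : topGroupType) : Prop :=
  exists2 A : set H, compact A & smallest (@subgroup H) A = [set: H].

Section Amenability.
Local Open Scope ring_scope.
Variables (R : realType) (H : topGroupType).

Definition bounded_continuous (f : H -> R) : Prop :=
  continuous f /\ [bounded f x | x in [set: H]].

(* A mean is a functional on bounded continuous functions; the values of m
   outside that space are irrelevant. *)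
Definition left_invariant_mean (m : (H -> R) -> R) : Prop :=
  [/\ forall (a : R) f g, bounded_continuous f -> bounded_continuous g ->
        m (fun x => a * f x + g x) = a * m f + m g,
      forall f, bounded_continuous f -> (forall x, 0 <= f x) -> 0 <= m f,
      m (fun=> 1) = 1 &
      forall (h : H) f, bounded_continuous f ->
        m (fun x => f (h^-1 * x)%g) = m f].

Definition amenable : Prop := exists m, left_invariant_mean m.

End Amenability.

Section Scale.
Variable H : topGroupType.

Definition scale_values (g : H) : set nat :=
  [set n | exists2 U, compact_open_subgroup U &
     has_index (conj_set g U) (conj_set g U `&` U) n].

(* In a t.d.l.c. group the minimum exists, so the default 0 is not used. *)
Definition scale (g : H) : nat :=
  xget 0%N [set n | scale_values g n /\
                    forall m, scale_values g m -> (n <= m)%N].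

Definition uniscalar_elt (g : H) : Prop := scale g = 1%N /\ scale g^-1 = 1%N.

End Scale.

Definition uniscalar (H : topGroupType) : Prop :=
  forall g : H, uniscalar_elt g.

Record closed_normal_subgroup (H : topGroupType) := ClosedNormalSubgroup {
  cns_set : set H ;
  cns_normal : normal_subgroup cns_set ;
  cns_closed : closed cns_set }.

Section Quotient.
Local Open Scope quotient_scope.
Variables (H : topGroupType) (N : closed_normal_subgroup H).

Local Notation K := (cns_set N).

Let K1 : K 1. Proof. by have [[]] := cns_normal N. Qed.
Let KM x y : K x -> K y -> K (x * y).
Proof. by have [[_ + _] _] := cns_normal N; apply. Qed.
Let KV x : K x -> K x^-1.
Proof. by have [[_ _ +] _] := cns_normal N; apply. Qed.
Let KJ g x : K x -> K (g * x * g^-1).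
Proof. by move=> Kx; rewrite -((cns_normal N).2 g); exists x. Qed.

Definition coset_rel (x y : H) : bool := `[< K (x^-1 * y) >].

Fact coset_rel_refl : reflexive coset_rel.
Proof. by move=> x; apply/asboolP; rewrite mulVg. Qed.

Fact coset_rel_sym : symmetric coset_rel.
Proof.
by move=> x y; apply/asboolP/asboolP => /KV; rewrite invgM invgK.
Qed.

Fact coset_rel_trans : transitive coset_rel.
Proof.
move=> y x z /asboolP Kxy /asboolP Kyz; apply/asboolP.
by have := KM Kxy Kyz; rewrite mulgA mulgK.
Qed.

Canonical coset_equiv :=
  EquivRel coset_rel coset_rel_refl coset_rel_sym coset_rel_trans.

(* The quotient group H/K with the quotient topology *)
Definition quotient_group : Type := quotient_topology {eq_quot coset_equiv}.

HB.instance Definition _ := Topological.copy quotient_group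
  (quotient_topology {eq_quot coset_equiv}).
HB.instance Definition _ := Quotient.copy quotient_group
  (quotient_topology {eq_quot coset_equiv}).

Local Notation Q := quotient_group.

Lemma eq_pi_coset (x y : H) : \pi_Q x = \pi_Q y <-> K (x^-1 * y).
Proof.
split=> [/(@eqquotP _ coset_equiv)/asboolP//|Kxy].
by apply/(@eqquotP _ coset_equiv)/asboolP.
Qed.

Let repr_pi (x : H) : K (x^-1 * repr (\pi_Q x)).
Proof. by apply/eq_pi_coset; rewrite reprK. Qed.

Let mulq (a b : Q) : Q := \pi_Q (repr a * repr b).
Let invq (a : Q) : Q := \pi_Q (repr a)^-1.
Let oneq : Q := \pi_Q 1.

Let piM x y : \pi_Q (x * y) = mulq (\pi_Q x) (\pi_Q y).
Proof.
apply/eq_pi_coset; set x' := repr _; set y' := repr _.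
have -> : (x * y)^-1 * (x' * y') = (y^-1 * (x^-1 * x') * y^-1^-1) * (y^-1 * y').
  by rewrite invgM invgK !mulgA mulgK.
by apply: KM; [apply: KJ|]; exact: repr_pi.
Qed.

Let piV x : \pi_Q x^-1 = invq (\pi_Q x).
Proof.
apply/eq_pi_coset; set x' := repr _; rewrite invgK.
have -> : x * x'^-1 = x * (x^-1 * x')^-1 * x^-1.
  by rewrite invgM invgK !mulgA mulgK.
by apply/KJ/KV/repr_pi.
Qed.

Let pi_ind (P : Q -> Prop) : (forall x : H, P (\pi_Q x)) -> forall a, P a.
Proof. by move=> Ppi a; rewrite -[a]reprK. Qed.

Let mulqA : associative mulq.
Proof.
by elim/pi_ind=> x; elim/pi_ind=> y; elim/pi_ind=> z; rewrite -!piM mulgA.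
Qed.
Let mul1q : left_id oneq mulq.
Proof. by elim/pi_ind=> x; rewrite -piM mul1g. Qed.
Let mulq1 : right_id oneq mulq.
Proof. by elim/pi_ind=> x; rewrite -piM mulg1. Qed.
Let mulVq : left_inverse oneq invq mulq.
Proof. by elim/pi_ind=> x; rewrite -piV -piM mulVg. Qed.
Let mulqV : right_inverse oneq invq mulq.
Proof. by elim/pi_ind=> x; rewrite -piV -piM mulgV. Qed.

HB.instance Definition _ :=
  isGroup.Build quotient_group mulqA mul1q mulq1 mulVq mulqV.

Lemma pi_mulg : {morph (\pi_Q : H -> Q) : x y / x * y}.
Proof. exact: piM. Qed.

Lemma pi_invg x : \pi_Q x^-1 = (\pi_Q x)^-1.
Proof. exact: piV. Qed.

Lemma pi_quotient_continuous : continuous (\pi_Q : H -> Q).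
Proof. exact: (@pi_continuous H {eq_quot coset_equiv}). Qed.

Lemma open_quotientE (U : set Q) : open U = open (\pi_Q @^-1` U : set H).
Proof. by []. Qed.

Let mulr_continuous (k : H) : continuous (fun x : H => x * k).
Proof.
move=> x; apply: (@continuous_comp _ _ _ (fun x : H => (x, k))
  (fun p : H * H => p.1 * p.2)); last exact: mulg_continuous.
by apply: cvg_pair; [exact: cvg_id | exact: cvg_cst].
Qed.

Lemma pi_quotient_open (U : set H) : open U -> open (\pi_Q @` U : set Q).
Proof.
move=> oU; rewrite open_quotientE.
have -> : \pi_Q @^-1` (\pi_Q @` U) =
          \bigcup_(k in K) ((fun x : H => x * k) @^-1` U).
  apply/seteqP; split=> [x [u Uu /eq_pi_coset Kux]|x [k Kk Uxk]] /=.
    by exists (u^-1 * x)^-1; [exact: KV | rewrite /= invgM invgK mulgA mulgV mul1g].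
  by exists (x * k) => //; apply/eq_pi_coset; rewrite invgM -mulgA mulVg mulg1;
     exact: KV.
apply: bigcup_open => k _; apply: open_comp => // x _; exact: mulr_continuous.
Qed.

Fact quotient_mulg_continuous : continuous (fun x : Q * Q => x.1 * x.2).
Proof.
case=> a b; elim/pi_ind: a => x; elim/pi_ind: b => y /= A.
rewrite -pi_mulg => /pi_quotient_continuous/(mulg_continuous (x, y)).
case=> -[/= B C] [Bx Cy] BC.
exists ((\pi_Q @` B^°), (\pi_Q @` C^°)) => /=.
  by split; apply: open_nbhs_nbhs; split;
    [exact/pi_quotient_open/open_interior | exists x
    |exact/pi_quotient_open/open_interior | exists y].
move=> [_ _] /= [[u Bu <-] [v Cv <-]]; rewrite -pi_mulg.
by apply: (BC (u, v)); split; exact: interior_subset.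
Qed.

Fact quotient_invg_continuous : continuous (fun x : Q => x^-1).
Proof.
apply/quotient_continuous.
have -> : (fun a : Q => a^-1) \o \pi_Q = \pi_Q \o (fun x : H => x^-1).
  by apply/funext => x /=; rewrite pi_invg.
move=> x; apply: continuous_comp; first exact: invg_continuous.
exact: pi_quotient_continuous.
Qed.

HB.instance Definition _ := isTopologicalGroup.Build quotient_group
  quotient_mulg_continuous quotient_invg_continuous.

End Quotient.

Definition topological_isomorphism (A B : topGroupType) (f : A -> B) : Prop :=
  [/\ {morph f : x y / x * y}, continuous f &
      exists g : B -> A, [/\ cancel f g, cancel g f & continuous g]].

Definition isomorphic (A B : topGroupType) : Prop :=
  exists f : A -> B, topological_isomorphism f.

Definition has_quotient_isomorphic_to (N H : topGroupType) : Prop :=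
  exists K : closed_normal_subgroup H, isomorphic (quotient_group K) N.

Definition no_nontrivial_compact_normal_subgroup (N : topGroupType) : Prop :=
  forall K : set N, normal_subgroup K -> compact K -> K = [set 1].

(* Main.v *)
Require Import Defs.
From mathcomp Require Import all_boot all_order all_algebra.
From mathcomp Require Import all_classical all_reals all_analysis.
From mathcomp Require Import lra.
Import numFieldNormedType.Exports.

Set Implicit Arguments.
Unset Strict Implicit.
Unset Printing Implicit Defensive.

Import Order.TTheory GRing.Theory Num.Theory.

Local Open Scope classical_set_scope.
Local Open Scope group_scope.

(** Let phi : G -> H1 and psi : G -> H2 be completion maps of the same size.
    The closure S of the set of all pairs (phi g, psi g) is a closed subgroup
    of H1 * H2, and both of its projections, to H1 and to H2, are surjective,
    open and proper; in particular they have compact kernels, so H1 and H2 are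
    quotients of one group by compact normal subgroups.  Everything rests on
    one fact: if R1 and R2 are compact open subgroups of H1 and H2, the
    preimages of R1 and R2 in G have finite index over their intersection.
    Hence the elements of S whose first coordinate lies in R1 have their second
    coordinate in finitely many cosets of R2 ([joint_image_bounded]), which
    gives properness; and the image of R1 under S is a closed subgroup of which
    finitely many cosets cover R2 ([joint_image_open]), which gives openness
    and, by density, surjectivity.

    Rather than as a third group, S is used as a relation from H1 to H2, a
    [proper_correspondence]; [joint_closureC] exchanges the two sides.  Each
    property then travels from H1 to H2 along S.  Compact sets and compact open
    subgroups have images of the same kind, which settles sigma-compactness,
    compact generation and, since the scale of g is 1 exactly when some compact
    open subgroup is mapped into itself by conjugation by g ([scale1P]),
    uniscalarity.  If q : H1 -> N is a quotient map and N has no non-trivial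
    compact normal subgroup, then q kills the compact normal subgroup
    {x | S x 1}, so that y |-> q x, for any x with S x y, is a well-defined
    quotient map of H2 ([quotient_corr]).

    Amenability ([amenable_corr]) requires averaging over a compact group.  Let
    K be a compact open subgroup of H1 and L its image under S, and let E be an
    L-invariant mean on bounded continuous functions restricted to L.  A
    function f on H2 is turned into the function F f : x |-> E (f (y _)) on H1,
    for any y with S x y; the invariance of E makes this independent of y and
    constant on the cosets x K, hence continuous, and f |-> F f is
    equivariant, so an invariant mean on H1 composed with F is one on H2.  The
    mean E is an ultrafilter limit, over open subgroups U shrinking to 1, of
    averages over representatives of L / U ([compact_invariant_mean]); arbitrarily
    small U exist because L is profinite ([van_dantzig]). *)

(** * Topological preliminaries *)

Section Translations.
Variable H : topGroupType.
Implicit Types U V K : set H.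

Lemma mulgl_continuous (g : H) : continuous (fun x : H => g * x).
Proof.
move=> x; apply: (@continuous_comp _ _ _ (fun x : H => (g, x))
  (fun p : H * H => p.1 * p.2)); last exact: mulg_continuous.
by apply: cvg_pair; [exact: cvg_cst | exact: cvg_id].
Qed.

Lemma mulgr_continuous (g : H) : continuous (fun x : H => x * g).
Proof.
move=> x; apply: (@continuous_comp _ _ _ (fun x : H => (x, g))
  (fun p : H * H => p.1 * p.2)); last exact: mulg_continuous.
by apply: cvg_pair; [exact: cvg_id | exact: cvg_cst].
Qed.

(** The left coset of U by g, written as a preimage so that open and closed
    sets are translated by continuity alone; [lcosetE] gives the image form. *)
Definition lcoset (g : H) U : set H := [set x | U (g^-1 * x)].

Lemma open_lcoset g U : open U -> open (lcoset g U).
Proof. by move=> oU; apply: open_comp => // x _; exact: mulgl_continuous. Qed.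

Lemma closed_lcoset g U : closed U -> closed (lcoset g U).
Proof. by move=> cU; apply: closed_comp => // x _; exact: mulgl_continuous. Qed.

Lemma nbhs_lcoset g U : open U -> U 1 -> nbhs g (lcoset g U).
Proof.
move=> oU U1; apply: open_nbhs_nbhs; split; first exact: open_lcoset.
by rewrite /lcoset /= mulVg.
Qed.

Lemma lcosetE g U : lcoset g U = (fun x => g * x) @` U.
Proof.
apply/seteqP; split=> [x Ux|_ [u Uu <-]]; last by rewrite /lcoset /= mulgA mulVg mul1g.
by exists (g^-1 * x) => //; rewrite mulgA mulgV mul1g.
Qed.

Lemma compact_lcoset g U : compact U -> compact (lcoset g U).
Proof.
move=> cU; rewrite lcosetE; apply: continuous_compact => //.
by apply: continuous_subspaceT => x; exact: mulgl_continuous.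
Qed.

(** It is enough that the subgroup be a neighbourhood of 1, since it can then
    be translated to any of its points. *)
Lemma subgroup_open U V : subgroup U -> nbhs (1 : H) V -> V `<=` U -> open U.
Proof.
move=> [_ UM _] V1 VU; rewrite openE => x Ux.
have : nbhs x (lcoset x V).
  by apply: (@mulgl_continuous x^-1 x V); rewrite mulVg.
by apply: filterS => y /VU /(UM _ _ Ux); rewrite mulgA mulgV mul1g.
Qed.

Lemma open_subgroup_closed U : subgroup U -> open U -> closed U.
Proof.
move=> [U1 UM UV] oU x /(_ (lcoset x U)) [|y [Uy /UV]].
  exact: nbhs_lcoset.
by rewrite invgM invgK => /(UM _ _ Uy); rewrite mulgA mulgV mul1g.
Qed.

Lemma lcosetM (x y : H) U : lcoset x (lcoset y U) = lcoset (x * y) U.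
Proof. by apply/funext => z; rewrite /lcoset /= invgM mulgA. Qed.

Lemma lcoset1 U : lcoset 1 U = U.
Proof. by apply/funext => z; rewrite /lcoset /= invg1 mul1g. Qed.

End Translations.

Lemma morph1 (H N : topGroupType) (q : H -> N) : {morph q : x y / x * y} -> q 1 = 1.
Proof.
move=> qM; have := qM 1 1; rewrite mulg1 => /(congr1 (fun z => (q 1)^-1 * z)).
by rewrite mulgA mulVg mul1g.
Qed.

Lemma morphV (H N : topGroupType) (q : H -> N) : {morph q : x y / x * y} ->
  {morph q : x / x^-1}.
Proof.
move=> qM x; have : q x^-1 * q x = 1 by rewrite -qM mulVg morph1.
by move=> /(congr1 (fun z => z * (q x)^-1)); rewrite -mulgA mulgV mulg1 mul1g.
Qed.

Lemma dense_nbhs (G : Type) (H : topologicalType) (f : G -> H) (x : H) (U : set H) :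
  dense (range f) -> nbhs x U -> exists g, U (f g).
Proof.
move=> fd; rewrite nbhsE => -[W [oW Wx] WU].
have W0 : W !=set0 by exists x.
have [y [Wy [g _ gy]]] := fd _ W0 oW.
by exists g; rewrite gy; exact: WU.
Qed.

Lemma compact_bigcup_finite (T : topologicalType) (I : choiceType)
    (D : set I) (F : I -> set T) :
  finite_set D -> (forall i, D i -> compact (F i)) ->
  compact (\bigcup_(i in D) F i).
Proof.
move=> fD cF; rewrite -bigsetU_fset_set//; rewrite big_seq.
elim/big_ind: _ => [|A B|i]; [exact: compact0|exact: compactU|].
by rewrite in_fset_set// inE => /cF.
Qed.

(** Near-covering along the filter generated by the sets of all sequences that
    contain a given finite one. *)
Lemma compact_finite_subcover (T : topologicalType) (I : eqType) (K : set T)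
    (F : I -> set T) :
  compact K -> (forall i, open (F i)) -> (forall x, K x -> exists i, F i x) ->
  exists s : seq I, forall x, K x -> exists2 i, i \in s & F i x.
Proof.
move=> /compact_near_coveringP cK oF FK.
pose N : set_system (seq I) :=
  filter_from [set: seq I] (fun s0 => [set s | {subset s0 <= s}]).
have FN : Filter N.
  apply: filter_from_filter; first by exists [::].
  move=> s t _ _; exists (s ++ t) => // u stu.
  by split=> x xs; apply: stu; rewrite mem_cat xs ?orbT.
case: (cK _ N (fun s x => exists2 i, i \in s & F i x) FN) => [x Kx|s _ /(_ s) sK].
  have [i Fix] := FK x Kx.
  exists (F i, [set s | {subset [:: i] <= s}]).
    split; last by exists [:: i].
    by apply: open_nbhs_nbhs; split => //; exact: oF.
  by move=> [x' s] /= [Fix' gs]; exists i => //; apply: gs; rewrite mem_head.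
by exists s => x Kx; exact: sK.
Qed.

(** * Indices of subgroups and the scale *)

Section Index.
Variable H : groupType.

Lemma lcosets_nonempty (U V : set H) : U 1 -> ~ has_index U V 0.
Proof.
move=> U1; rewrite /has_index II0 card_eq0 => /eqP E.
have : lcosets U V [set 1 * x | x in V] by exists 1.
by rewrite E.
Qed.

(** The intersection is itself one of the cosets counted; if it is the only
    one, every u in U lies in it. *)
Lemma has_index1 (U V : set H) : subgroup U -> subgroup V ->
  has_index U (U `&` V) 1 <-> U `<=` V.
Proof.
move=> [U1 UM UV] [V1 VM VV]; split.
  move=> /card_set_bijP [f [fI finj _]] u Uu.
  have eqc x : U x -> lcosets U (U `&` V) [set x * w | w in U `&` V].
    by move=> Ux; exists x.
  have E : [set 1 * w | w in U `&` V] = [set u * w | w in U `&` V].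
    apply: finj; rewrite ?inE; [exact: eqc|exact: eqc|].
    have := fI _ (eqc _ U1); have := fI _ (eqc _ Uu).
    by rewrite /= !ltnS !leqn0 => /eqP -> /eqP ->.
  have : [set 1 * w | w in U `&` V] u.
    by rewrite E; exists 1 => //; rewrite mulg1.
  by case=> w [_ Vw]; rewrite mul1g => <-.
move=> UsubV; rewrite /has_index.
have -> : lcosets U (U `&` V) = [set U].
  apply/seteqP; split=> [_ [x Ux <-]|_ ->].
    apply/seteqP; split=> [_ [w [Uw _] <-]|y Uy]; first exact: UM.
    exists (x^-1 * y); last by rewrite mulgA mulgV mul1g.
    by have : U (x^-1 * y) by [apply: UM => //; exact: UV]; split=> //; exact: UsubV.
  exists 1 => //; apply/seteqP; split=> [_ [w [Uw _] <-]|y Uy]; rewrite ?mul1g//.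
  by exists y; rewrite ?mul1g//; split=> //; exact: UsubV.
apply/card_set_bijP; exists (fun=> 0%N); split=> // [C D|n].
  by rewrite !inE => -> ->.
by rewrite /= ltnS leqn0 => /eqP ->; exists U.
Qed.

Lemma subgroup_conj (g : H) U : subgroup U -> subgroup (conj_set g U).
Proof.
move=> [U1 UM UV]; split.
- by exists 1; rewrite // mulg1 mulgV.
- move=> _ _ [x Ux <-] [y Uy <-]; exists (x * y); first exact: UM.
  by rewrite !mulgA mulgVK.
- move=> _ [x Ux <-]; exists x^-1; first exact: UV.
  by rewrite !invgM invgK mulgA.
Qed.

End Index.

(** An index is never 0, so the minimum defining the scale is 1 as soon as the
    value 1 is attained. *)
Lemma scale1P (H : topGroupType) (g : H) : scale g = 1%N <->
  exists2 U : set H, compact_open_subgroup U & conj_set g U `<=` U.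
Proof.
rewrite /scale; split.
  case: xgetP => [n -> [[U coU hU] _] n1|//].
  rewrite n1 in hU; exists U => //.
  by apply/(has_index1 (subgroup_conj _ _) _); case: coU.
move=> [U coU UU]; have sU : subgroup U by case: coU.
have v1 : scale_values g 1%N.
  by exists U => //; apply/has_index1 => //; exact: subgroup_conj.
have pos m : scale_values g m -> (0 < m)%N.
  case: m => // -[V [sV _ _] h0]; exfalso; apply: lcosets_nonempty h0.
  by have [] := subgroup_conj g sV.
have P1 : [set n | scale_values g n /\
    forall m, scale_values g m -> (n <= m)%N] 1%N by split.
have [v minv] := xgetPex 0%N (ex_intro _ _ P1).
by apply/eqP; rewrite eqn_leq minv// pos.
Qed.

Lemma commensurate_refl (G : groupType) (U : set G) :
  subgroup U -> commensurate U U.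
Proof. by move=> sU; split; exists 1%N; apply/has_index1. Qed.

(** D consists of one representative of each left coset of W by an element
    of V. *)
Lemma finite_index_cover (G : groupType) (V W : set G) :
  W 1 -> finite_index V W ->
  exists2 D : set G, finite_set D & forall x, V x -> exists2 d, D d & W (d^-1 * x).
Proof.
move=> W1 fVW.
pose rep (C : set G) : G := xget 1 [set x | C = [set x * v | v in W]].
exists (rep @` lcosets V W); first exact: finite_image.
move=> x Vx; set C := [set x * v | v in W].
exists (rep C); first by exists C => //; exists x.
have Cx : C x by exists 1; rewrite ?mulg1.
have -> : rep C = xget 1 [set x | C = [set x * v | v in W]] by [].
case: xgetP => [d _ /= Cd|/(_ x)/=]; last by [].
by move: Cx; rewrite Cd => -[w Ww <-]; rewrite mulgA mulVg mul1g.
Qed.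

(** * Proper correspondences between topological groups *)

Section RelImage.
Variables (A B : Type) (S : A -> B -> Prop).

Definition rel_image (U : set A) : set B := [set y | exists2 x, U x & S x y].

End RelImage.

(** A subgroup S of A * B, given as a relation, that projects onto both
    factors and is seen from A: [corr_compact] reflects properness of the
    projection to A, and [corr_open] openness of the projection to B. *)
Record proper_correspondence (A B : topGroupType) (S : A -> B -> Prop) : Prop :=
  ProperCorrespondence {
  corrM : forall x x' y y', S x y -> S x' y' -> S (x * x') (y * y') ;
  corrV : forall x y, S x y -> S x^-1 y^-1 ;
  corr_total : forall x, exists y, S x y ;
  corr_surj : forall y, exists x, S x y ;
  corr_compact : forall K, compact K -> compact (rel_image S K) ;
  corr_open : forall U, open U -> open (rel_image S U) }.

Section Transfer.
Variables (A B : topGroupType) (S : A -> B -> Prop).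
Hypothesis pS : proper_correspondence S.

Lemma corr1 : S 1 1.
Proof.
have [x Sx] := corr_surj pS 1.
by have := corrM pS (corrV pS Sx) Sx; rewrite !mulVg.
Qed.

Lemma subgroup_rel_image U : subgroup U -> subgroup (rel_image S U).
Proof.
move=> [U1 UM UV]; split=> [|y y' [x Ux Sx] [x' Ux' Sx']|y [x Ux Sx]].
- by exists 1 => //; exact: corr1.
- by exists (x * x'); [exact: UM|exact: corrM].
- by exists x^-1; [exact: UV|exact: corrV].
Qed.

Lemma compact_open_subgroup_rel_image U :
  compact_open_subgroup U -> compact_open_subgroup (rel_image S U).
Proof.
case=> sU cU oU; split.
- exact: subgroup_rel_image.
- exact: corr_compact pS _ cU.
- exact: corr_open pS _ oU.
Qed.

Lemma sigma_compact_corr : sigma_compact A -> sigma_compact B.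
Proof.
case=> K cK KT; exists (fun n => rel_image S (K n)).
  by move=> n; exact: (corr_compact pS).
rewrite -subTset => y _; have [x Sxy] := corr_surj pS y.
by have [n _ Knx] : (\bigcup_n K n) x; [rewrite KT|exists n => //; exists x].
Qed.

(** The generating set is enlarged by 1 so that its image contains the compact
    group {z | S 1 z}, the ambiguity in lifting elements of A to B. *)
Lemma compactly_generated_corr : compactly_generated A -> compactly_generated B.
Proof.
case=> K cK genK; exists (rel_image S (K `|` [set 1])).
  by apply: (corr_compact pS); apply: compactU => //; exact: compact_set1.
rewrite -subTset => y _ D [[D1 DM DV] KD].
(* elements all of whose partners lie in D form a subgroup, by kerD below *)
pose E : set A := [set x | forall y, S x y -> D y].
suff : [set: A] `<=` E by have [x Sxy] := corr_surj pS y; move=> /(_ x I); exact.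
rewrite -genK => x; apply; split; last first.
  by move=> k Kk z Skz; apply: KD; exists k => //; left.
have kerD z : S 1 z -> D z by move=> S1z; apply: KD; exists 1 => //; right.
split=> [z /kerD//|a b Ea Eb z Sabz|a Ea z Sz].
- have [u Sau] := corr_total pS a.
  have -> : z = u * (u^-1 * z) by rewrite mulgA mulgV mul1g.
  apply: DM; first exact: Ea.
  apply: Eb; have := corrM pS (corrV pS Sau) Sabz.
  by rewrite mulgA mulVg mul1g.
- by rewrite -[z]invgK; apply/DV/Ea; rewrite -[a]invgK; exact: corrV.
Qed.

End Transfer.

Lemma uniscalar_corr (A B : topGroupType) (S : A -> B -> Prop) :
  proper_correspondence S -> uniscalar A -> uniscalar B.
Proof.
move=> pS uA; suff sc1 (y : B) : scale y = 1%N by move=> y; split; exact: sc1.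
have [x Sxy] := corr_surj pS y; have [/scale1P[U coU UU] _] := uA x.
apply/scale1P; exists (rel_image S U).
  exact: compact_open_subgroup_rel_image.
move=> _ [z [u Uu Suz] <-]; exists (x * u * x^-1); first by apply: UU; exists u.
by apply: (corrM pS); [exact: corrM|exact: corrV].
Qed.

(** * Quotients without compact normal subgroups *)

Section Quotients.
Local Open Scope quotient_scope.

(** The maps that are quotient maps up to isomorphism when the target is
    Hausdorff, by the two lemmas below; they spare handling cosets. *)
Definition open_epimorphism (H N : topGroupType) (q : H -> N) : Prop :=
  [/\ {morph q : x y / x * y}, continuous q,
      forall U, open U -> open (q @` U) & forall n, exists x, q x = n].

Lemma quotient_open_epimorphism (H N : topGroupType) :
  has_quotient_isomorphic_to N H -> exists q : H -> N, open_epimorphism q.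
Proof.
move=> [K [f [fM fc [g [fg gf gc]]]]].
exists (fun x => f (\pi_(quotient_group K) x)); split.
- by move=> x y; rewrite pi_mulg fM.
- move=> x; apply: (@continuous_comp _ _ _ (\pi_(quotient_group K) : H -> quotient_group K) f).
    exact: pi_quotient_continuous.
  exact: fc.
- move=> U oU.
  have -> : [set f (\pi_(quotient_group K) x) | x in U] =
            g @^-1` ((\pi_(quotient_group K) : H -> quotient_group K) @` U).
    apply/seteqP; split=> [_ [x Ux <-]|n [x Ux xn]]; first by exists x; rewrite ?fg.
    by exists x => //; rewrite xn gf.
  by apply: open_comp => [x _|]; [exact: gc|exact: pi_quotient_open].
- by move=> n; exists (repr (g n)); rewrite reprK gf.
Qed.

Lemma open_epimorphism_quotient (H N : topGroupType) (q : H -> N) :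
  hausdorff_space N -> open_epimorphism q -> has_quotient_isomorphic_to N H.
Proof.
move=> hN [qM qc qo qs].
have K_normal : normal_subgroup (q @^-1` [set 1]).
  split.
    split=> [|x y /= qx qy|x /= qx]; rewrite /= ?morph1//.
      by rewrite qM qx qy mulg1.
    by rewrite morphV// qx invg1.
  move=> g; apply/seteqP; split=> [_ [x /= qx <-]|x /= qx].
    by rewrite /= !qM qx mulg1 morphV// mulgV.
  exists (g^-1 * x * g); first by rewrite /= !qM qx mulg1 morphV// mulVg.
  by rewrite !mulgA mulgV mul1g mulgK.
have K_closed : closed (q @^-1` [set 1]).
  apply: closed_comp => [x _|]; first exact: qc.
  by apply: (compact_closed hN); exact: compact_set1.
pose K := ClosedNormalSubgroup K_normal K_closed.
pose f (a : quotient_group K) : N := q (repr a).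
have fpi x : f (\pi x) = q x.
  have : cns_set K (x^-1 * repr (\pi_(quotient_group K) x)).
    by apply/eq_pi_coset; rewrite reprK.
  rewrite /= qM morphV// => /(congr1 (fun z => q x * z)).
  by rewrite mulgA mulgV mul1g mulg1.
exists K, f; split.
- by move=> a b; rewrite -[a]reprK -[b]reprK -pi_mulg !fpi qM.
- apply/quotient_continuous.
  suff -> : f \o \pi_(quotient_group K) = q by [].
  by apply/funext => x /=; rewrite fpi.
- have [s qsn] := choice qs.
  exists (fun n => \pi_(quotient_group K) (s n)); split.
  + move=> a; rewrite -[RHS]reprK; apply/eq_pi_coset.
    by rewrite /= qM morphV// qsn /f mulVg.
  + by move=> n; rewrite fpi.
  + apply/continuousP => U oU.
    have -> : (fun n => \pi_(quotient_group K) (s n)) @^-1` U =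
              q @` (\pi_(quotient_group K) @^-1` U).
      apply/seteqP; split=> [n Un|_ [x /= Ux <-]].
        by exists (s n).
      rewrite /=; suff -> : \pi_(quotient_group K) (s (q x)) = \pi_(quotient_group K) x by [].
      by apply/eq_pi_coset; rewrite /= qM morphV// qsn mulVg.
    by apply: qo; rewrite -open_quotientE.
Qed.

End Quotients.

(** The ambiguity group {x | S x 1} is compact and normal because S projects
    onto A, so its image under a quotient map q : A -> N is a compact normal
    subgroup of N, hence trivial.  Therefore q x depends only on a partner y of
    x, and y |-> q x is again an open epimorphism: continuity uses that S maps
    open sets of A to open sets, openness the same for the reverse relation. *)
Lemma quotient_corr (A B N : topGroupType) (S : A -> B -> Prop) :
  proper_correspondence S -> proper_correspondence (fun y x => S x y) ->
  hausdorff_space N -> no_nontrivial_compact_normal_subgroup N ->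
  has_quotient_isomorphic_to N A -> has_quotient_isomorphic_to N B.
Proof.
move=> pS pS' hN nN /quotient_open_epimorphism[q [qM qc qo qs]].
have kerq x : S x 1 -> q x = 1.
  pose K : set N := q @` rel_image (fun y x => S x y) [set 1].
  have cK : compact K.
    apply: continuous_compact; first exact: continuous_subspaceT.
    by apply: (corr_compact pS'); exact: compact_set1.
  suff /nN/(_ cK) K1 : normal_subgroup K.
    by move=> Sx1; have : K (q x) by [exists x => //; exists 1]; rewrite K1.
  split.
    split.
    - by exists 1; [exists 1 => //; exact: corr1|exact: morph1].
    - move=> _ _ [u [_ -> Su] <-] [v [_ -> Sv] <-]; exists (u * v) => //.
      by exists 1 => //; rewrite -[1]mulg1; exact: corrM.
    - move=> _ [u [_ -> Su] <-]; exists u^-1; last exact: morphV.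
      by exists 1 => //; rewrite -invg1; exact: corrV.
  have KJ n k : K k -> K (n * k * n^-1).
    case=> u [_ -> Su] <-; have [x0 <-] := qs n; have [y Sy] := corr_total pS x0.
    exists (x0 * u * x0^-1); last by rewrite !qM morphV.
    exists 1 => //; rewrite -(mulgV y) -{1}[y]mulg1.
    by apply: (corrM pS); [exact: corrM|exact: corrV].
  move=> n; apply/seteqP; split=> [_ [k Kk <-]|k Kk]; first exact: KJ.
  exists (n^-1 * k * n); first by have := KJ n^-1 k Kk; rewrite invgK.
  by rewrite !mulgA mulgV mul1g mulgK.
have [s sS] := choice (corr_surj pS).
have q2E x y : S x y -> q (s y) = q x.
  move=> Sxy; have : S (x^-1 * s y) 1.
    by rewrite -(mulVg y); apply: (corrM pS) => //; exact: corrV.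
  move=> /kerq; rewrite qM morphV// => /(congr1 (fun z => q x * z)).
  by rewrite mulgA mulgV mul1g mulg1.
apply: (open_epimorphism_quotient (q := q \o s)) => //; split.
- by move=> y z /=; rewrite -qM; apply: q2E; exact: (corrM pS).
- apply/continuousP => U oU.
  have -> : (q \o s) @^-1` U = rel_image S (q @^-1` U).
    apply/seteqP; split=> [y Uy|y [x Ux /q2E]]; first by exists (s y).
    by rewrite /= => ->.
  by apply: (corr_open pS); apply: open_comp => // x _; exact: qc.
- move=> U oU.
  have -> : (q \o s) @` U = q @` (rel_image (fun y x => S x y) U).
    apply/seteqP; split=> [_ [y Uy <-]|_ [x [y Uy Sxy] <-]].
      by exists (s y) => //; exists y.
    by exists y => //=; exact: q2E.
  by apply: qo; exact: (corr_open pS').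
- move=> n; have [x <-] := qs n; have [y Sxy] := corr_total pS x.
  by exists y; exact: q2E.
Qed.

(** * Compact open subgroups form a basis at the identity *)

(** The finite intersection property, for a family closed under binary
    intersections. *)
Lemma compact_directed_closed (T : topologicalType) (K : set T)
    (D : set (set T)) :
  compact K -> D !=set0 -> (forall C, D C -> closed C) ->
  (forall C C', D C -> D C' -> D (C `&` C')) ->
  (forall x, K x -> exists2 C, D C & ~ C x) ->
  exists2 C, D C & K `&` C = set0.
Proof.
move=> cK D0 Dcl DI DK; apply: contrapT => nD.
have PF : ProperFilter (filter_from D (fun C => K `&` C)).
  apply: filter_from_proper; last first.
    by move=> C DC; apply/set0P/eqP => KC; apply: nD; exists C.
  apply: filter_from_filter => // C C' DC DC'.
  by exists (C `&` C'); [exact: DI|move=> x [Kx [Cx C'x]]].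
have [|x [Kx clx]] := cK _ PF.
  by have [C DC] := D0; exists C => // x [].
have [C DC nCx] := DK x Kx; apply: nCx; apply: Dcl => // V xV.
have [|y [[_ Cy] Vy]] := clx (K `&` C) V _ xV; first by exists C.
by exists y.
Qed.

Section TotallyDisconnected.
Variable T : topologicalType.
Hypotheses (hT : hausdorff_space T) (tdT : totally_disconnected [set: T]).
Variables (R : set T) (x : T).
Hypotheses (cR : compact R) (oR : open R) (Rx : R x).

Let D := [set C : set T | [/\ clopen C, C x & C `<=` R]].

Let D_R : D R.
Proof. by split=> //; split=> //; exact: (compact_closed hT). Qed.

Let DI C C' : D C -> D C' -> D (C `&` C').
Proof.
move=> [cC Cx CR] [cC' C'x _]; split; [exact: clopenI|by []|].
by move=> z [/CR].
Qed.

(** In a compact open set the quasi-component Q of x is connected, hence reduced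
    to x in a totally disconnected space.  If Q split into two disjoint closed
    pieces, normality would give an open set W around the piece containing x
    whose closure misses the other; by compactness some clopen C containing Q avoids
    the boundary of W, so C `&` W is a clopen neighbourhood of x missing
    part of Q. *)
Lemma quasi_component_point y : (forall C, D C -> C y) -> y = x.
Proof.
pose Q := \bigcap_(C in D) C.
have clQ : closed Q by apply: closed_bigI => C [[]].
have QR : Q `<=` R by move=> z; exact.
suff cQ : connected Q.
  move=> Qy; have Qx : Q x by move=> C [].
  have : connected_component [set: T] x y.
    by exists Q => //; split.
  by rewrite tdT.
apply/connectedP => E [E0 QE [sE1 sE2]].
have clE b : closed (E b).
  have EQ : E b `<=` Q by rewrite QE => z; case: b; [right|left].
  move=> z Ez; have : Q z by apply: clQ; exact: closure_subset Ez.
  rewrite QE => -[] zE; case: b Ez {EQ} => // Ez; exfalso.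
    by have : (E false `&` closure (E true)) z by []; rewrite sE2.
  by have : (closure (E false) `&` E true) z by []; rewrite sE1.
have Edisj : E false `&` E true = set0.
  rewrite -subset0 => z [Efz Etz].
  suff : (closure (E false) `&` E true) z by rewrite sE1.
  by split=> //; exact: subset_closure.
(* b is the index of the piece containing x *)
have [b Ebx] : exists b, E b x.
  have : Q x by move=> C [].
  by rewrite QE => -[]; [exists false|exists true].
have EbN z : E b z -> E (~~ b) z -> False.
  move=> h1 h2; suff : (E false `&` E true) z by rewrite Edisj.
  by case: b {Ebx} h1 h2.
have [W [oW EW WE]] : exists W : set T,
    [/\ open W, E b `<=` W & closure W `<=` ~` E (~~ b)].
  have ERi : E b `<=` R°.
    move: oR => /interior_id ->; apply: subset_trans QR; rewrite QE.
    by case: (b) => z; [right|left].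
  have snb : set_nbhs (E b) (~` E (~~ b)).
    apply/set_nbhsP; exists (~` E (~~ b)); split=> [|z Ebz|//].
      by apply: closed_openC; exact: clE.
    exact: EbN.
  have [V /set_nbhsP[W [oW EW WV]] VE] :=
    compact_normal_local hT cR ERi (clE b) snb.
  exists W; split=> //; apply: subset_trans VE; exact: closure_subset.
(* the boundary of W misses Q, so it misses some clopen C of the family *)
have [| | | |C DC CW] := @compact_directed_closed T (R `&` (closure W `\` W)) D _ _ _ DI.
- apply: compact_closedI => //; apply: closedI; first exact: closed_closure.
  exact: open_closedC.
- by exists R.
- by move=> C [[]].
- move=> z [Rz [clWz nWz]]; apply: contrapT => nD.
  have : Q z by move=> C DC; apply: contrapT => nCz; apply: nD; exists C.
  rewrite QE => Ez; have {Ez} : E b z \/ E (~~ b) z.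
    by case: Ez; case: (b); [right|left|left|right].
  by case=> [/EW//|]; exact: WE.
have [z Ez] := E0 (~~ b).
have Qz : Q z by rewrite QE; case: (b) Ez; [left|right].
have : D (C `&` W).
  have [[oC cC] Cx CR] := DC; split; [|by split=> //; exact: EW|by move=> u [/CR]].
  split; first exact: openI.
  have -> : C `&` W = C `&` closure W.
    apply/seteqP; split=> u [Cu Wu]; split=> //; first exact: subset_closure.
    apply: contrapT => nWu.
    suff : ((R `&` (closure W `\` W)) `&` C) u by rewrite CW.
    by split=> //; split=> //; exact: CR.
  by apply: closedI => //; exact: closed_closure.
by move=> /Qz [_ Wz]; apply: (WE z) => //; exact: subset_closure.
Qed.

Lemma clopen_basis U : nbhs x U -> exists C, [/\ clopen C, C x, C `<=` R & C `<=` U].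
Proof.
rewrite nbhsE => -[W [oW Wx] WU].
have [| | | |C [cC Cx CR] CW] := @compact_directed_closed T (R `&` ~` W) D _ _ _ DI.
- by apply: compact_closedI => //; exact: open_closedC.
- by exists R.
- by move=> C [[]].
- move=> z [Rz nWz]; apply: contrapT => nD; apply: nWz.
  suff -> : z = x by [].
  apply: quasi_component_point => C DC; apply: contrapT => nCz; apply: nD.
  by exists C.
exists C; split=> // z Cz; apply: WU; apply: contrapT => nWz.
suff : ((R `&` ~` W) `&` C) z by rewrite CW.
by split=> //; split=> //; exact: CR.
Qed.

End TotallyDisconnected.

(** Inside a clopen neighbourhood C of 1, the right stabilizer of C is a
    subgroup; it is contained in C because 1 is in C, and it is open because C is
    both compact and open. *)
Lemma van_dantzig (H : topGroupType) (R V : set H) :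
  hausdorff_space H -> totally_disconnected [set: H] ->
  compact_open_subgroup R -> nbhs 1 V ->
  exists U, [/\ compact_open_subgroup U, U `<=` R & U `<=` V].
Proof.
move=> hH tdH [[R1 _ _] cR oR] V1.
have [C [[oC clC] C1 CR CV]] := clopen_basis hH tdH cR oR R1 V1.
have cC : compact C by exact: subclosed_compact cR CR.
pose U := [set u : H | forall c, C c <-> C (c * u)].
have UC : U `<=` C by move=> u /(_ 1)[+ _] => /(_ C1); rewrite mul1g.
have sU : subgroup U.
  split=> [c|u v Uu Uv c|u Uu c]; first by rewrite mulg1.
    by rewrite mulgA; exact: iff_trans (Uu c) (Uv (c * u)).
  by apply: iff_sym; have := Uu (c * u^-1); rewrite mulgVK.
(* tube lemma: for u near 1 the compact set C is translated into the open C *)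
have near_stab (f : H -> H) : continuous f -> f 1 = 1 ->
    \forall u \near (1 : H), C `<=` (fun c => C (c * f u)).
  move=> fc f1; move: cC => /compact_near_coveringP; apply=> c Cc.
  have : nbhs (c * f 1) C by rewrite f1 mulg1; apply: open_nbhs_nbhs.
  have /(_ (c, (1:H))) : continuous (fun p : H * H => p.1 * f p.2).
    move=> [a b]; apply: (@continuous_comp _ _ _
      (fun p : H * H => (p.1, f p.2)) (fun p : H * H => p.1 * p.2)).
      apply: cvg_pair; first exact: cvg_fst.
      by apply: continuous_comp; [exact: cvg_snd|exact: fc].
    exact: mulg_continuous.
  by move=> h /h.
have oU : open U.
  have h1 := near_stab id (fun x => @cvg_id _ (nbhs x)) erefl.
  have h2 := near_stab (fun u => u^-1) (@invg_continuous H) (invg1 _).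
  apply: subgroup_open sU (filterI h1 h2) _ => u [Cu CVu] c.
  by split=> [/Cu//|/CVu]; rewrite mulgK.
exists U; split.
- split=> //; apply: subclosed_compact cR _; first exact: open_subgroup_closed.
  exact: subset_trans CR.
- exact: subset_trans CR.
- exact: subset_trans CV.
Qed.

(** * Invariant means on compact groups and amenability *)

Section Averages.
Local Open Scope ring_scope.
Variables (R : realType) (H : topGroupType) (K : set H).
Hypothesis coK : compact_open_subgroup K.
Implicit Types (U : set H) (f g : H -> R).

Let K1 : K 1%g. Proof. by case: coK => -[]. Qed.
Let KM x y : K x -> K y -> K (x * y)%g. Proof. by case: coK => -[_ + _] _ _; exact. Qed.
Let KV x : K x -> K x^-1%g. Proof. by case: coK => -[_ _ +] _ _; exact. Qed.

Lemma lcosets_finite U : subgroup U -> open U -> finite_set (lcosets K U).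
Proof.
move=> [U1 UM UV] oU; have [_ cK _] := coK.
have [|x _|s sK] := compact_finite_subcover (F := fun g : H => lcoset g U) cK.
- by move=> g; exact: open_lcoset.
- by exists x; rewrite /lcoset /= mulVg.
apply: (@sub_finite_set _ _ ((fun g : H => lcoset g U) @` [set` s])); last first.
  by apply: finite_image; exact: finite_seq.
move=> _ [x Kx <-]; have [g gs gx] := sK x Kx; exists g => //.
rewrite -lcosetE; apply/seteqP; split=> y; rewrite /lcoset /= => Uy.
  have := UM _ _ (UV _ gx) Uy.
  by rewrite invgM invgK mulgA mulgK.
by have := UM _ _ gx Uy; rewrite mulgA mulgK.
Qed.

Definition coset_rep (C : set H) : H := xget 1%g C.

Definition coset_count U : R := \sum_(C \in lcosets K U) (1 : R).

Definition coset_average U f : R :=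
  (coset_count U)^-1 * \sum_(C \in lcosets K U) f (coset_rep C).

Lemma lcosets_lcoset U C : lcosets K U C ->
  subgroup U -> C (coset_rep C) /\ C = lcoset (coset_rep C) U.
Proof.
move=> [x Kx <-] [U1 UM UV]; rewrite -lcosetE.
have : lcoset x U (coset_rep (lcoset x U)).
  rewrite /coset_rep; case: xgetP => [y _//|/(_ x)].
  by rewrite /lcoset /= mulVg.
set c := coset_rep _ => Uc; split=> //.
rewrite /lcoset /= in Uc; apply/seteqP; split=> y; rewrite /lcoset /= => Uy.
  by have := UM _ _ (UV _ Uc) Uy; rewrite invgM invgK mulgA mulgK.
by have := UM _ _ Uc Uy; rewrite mulgA mulgK.
Qed.

Section Subgroup.
Variable U : set H.
Hypotheses (sU : subgroup U) (oU : open U) (UK : U `<=` K).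

Let fin := lcosets_finite sU oU.

Lemma coset_rep_K C : lcosets K U C -> K (coset_rep C).
Proof.
move=> CU; have [+ _] := lcosets_lcoset CU sU.
by case: CU => x Kx <- [u Uu <-]; apply: KM => //; exact: UK.
Qed.

Lemma coset_count_gt0 : 0 < coset_count U.
Proof.
rewrite /coset_count.
have KU : lcosets K U [set (1 * u)%g | u in U] by exists 1%g.
rewrite (fsbigD1 [set (1 * u)%g | u in U])//=.
by apply: ltr_pwDl => //; exact: fsumr_ge0.
Qed.

Lemma coset_average_linear a f g :
  coset_average U (fun x => a * f x + g x) =
  a * coset_average U f + coset_average U g.
Proof.
rewrite /coset_average fsbig_split//= -mulr_fsumr mulrDr; congr (_ + _).
by rewrite mulrCA.
Qed.

Lemma coset_average_cst a : coset_average U (fun=> a) = a.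
Proof.
rewrite /coset_average -[a in LHS]mulr1 -mulr_fsumr mulrCA mulVf ?mulr1//.
by rewrite gt_eqF// coset_count_gt0.
Qed.

Lemma coset_average_ge0 f : (forall x, K x -> 0 <= f x) -> 0 <= coset_average U f.
Proof.
move=> f0; apply: mulr_ge0; first by rewrite invr_ge0 ltW// coset_count_gt0.
by apply: fsumr_ge0 => C /coset_rep_K; exact: f0.
Qed.

Lemma coset_average_le f M : (forall x, K x -> `|f x| <= M) ->
  `|coset_average U f| <= M.
Proof.
move=> fM; rewrite ler_norml; apply/andP; split.
  have : 0 <= coset_average U (fun x => 1 * f x + M).
    by apply: coset_average_ge0 => x /fM; rewrite ler_norml => /andP[]; lra.
  by rewrite coset_average_linear coset_average_cst; lra.
have : 0 <= coset_average U (fun x => -1 * f x + M).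
  by apply: coset_average_ge0 => x /fM; rewrite ler_norml => /andP[]; lra.
by rewrite coset_average_linear coset_average_cst; lra.
Qed.

Let shift_lcosets k C : K k -> lcosets K U C -> lcosets K U (lcoset k C).
Proof.
move=> Kk [x Kx <-]; exists (k * x)%g; first exact: KM.
by rewrite -!lcosetE lcosetM.
Qed.

(** Translation by k permutes the cosets and moves each representative to
    another element of the image coset, so the average changes by at most the
    oscillation of f along cosets of U. *)
Lemma coset_average_shift f k (e : R) : K k ->
  (forall x u, K x -> U u -> `|f (x * u)%g - f x| <= e) ->
  `|coset_average U (fun x => f (k * x)%g) - coset_average U f| <= e.
Proof.
move=> Kk fe.
have shift_bij : set_bij (lcosets K U) (lcosets K U) (lcoset k).
  split=> [C|C C' _ _ CC'|C CU]; first exact: shift_lcosets.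
    by rewrite -[C]lcoset1 -[C']lcoset1 -(mulVg k) -!lcosetM CC'.
  exists (lcoset k^-1%g C); first by apply: shift_lcosets => //; exact: KV.
  by rewrite lcosetM mulgV lcoset1.
rewrite /coset_average (reindex_fsbig (lcoset k) (lcosets K U) (lcosets K U)
  (fun C => f (coset_rep C)))//=.
rewrite -mulrBr normrM ger0_norm ?invr_ge0 ?(ltW coset_count_gt0)//.
rewrite ler_pdivrMl ?coset_count_gt0// /coset_count.
rewrite !fsbig_finite//= -sumrB.
apply: le_trans (ler_norm_sum _ _ _) _.
rewrite mulr_suml big_seq [leRHS]big_seq; apply: ler_sum => C.
rewrite in_fset_set// inE mul1r => CU.
have [_ CE] := lcosets_lcoset CU sU.
have [+ _] := lcosets_lcoset (shift_lcosets Kk CU) sU.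
set c := coset_rep C; set c' := coset_rep (lcoset k C).
rewrite CE lcosetM distrC => Uc'.
have -> : c' = (k * c * ((k * c)^-1 * c'))%g by rewrite mulgA mulgV mul1g.
apply: fe => //; apply: KM => //; exact: coset_rep_K.
Qed.

End Subgroup.

End Averages.

Lemma fmap_ultra (T U : Type) (f : T -> U) (F : set_system T) :
  UltraFilter F -> UltraFilter (f @ F).
Proof.
move=> FU; have PF := @ultra_proper _ _ FU.
split=> [|G PG FG]; first exact: fmap_proper_filter.
apply/seteqP; split=> [V GV|]; last exact: FG.
have [//|nV] := in_ultra_setVsetC (f @^-1` V) FU.
have /filter_ex[x []//] : G (V `&` ~` V) by apply: filterI => //; exact: FG.
Qed.

Section InvariantMean.
Local Open Scope ring_scope.
Variables (R : realType) (H : topGroupType).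

Lemma bounded_continuousP (f : H -> R) : bounded_continuous f <->
  continuous f /\ exists M, forall x, `|f x| <= M.
Proof.
split=> [[fc [M [_ fM]]]|[fc [M fM]]]; split=> //.
  exists (M + 1) => x; apply: (fM (M + 1) _ x I); first by rewrite ltrDl.
by exists M; split; [exact: num_real|move=> N /ltW MN x _; exact: le_trans MN].
Qed.

Lemma uniformly_continuous_compact (K : set H) (f : H -> R) (e : R) :
  compact K -> continuous f -> 0 < e ->
  \forall u \near (1%g : H), forall x, K x -> `|f (x * u)%g - f x| <= e.
Proof.
move=> /compact_near_coveringP cK fc e0.
apply: (cK _ (nbhs (1%g : H)) (fun u x => `|f (x * u)%g - f x| <= e)) => x Kx.
pose g (p : H * H) : R := f (p.1 * p.2)%g - f p.1.
have gc : continuous g.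
  move=> p; apply: cvgB.
    by apply: (continuous_comp (mulg_continuous p)); exact: fc.
  by apply: (@continuous_comp _ _ _ fst f); [exact: cvg_fst|exact: fc].
have := gc (x, 1%g); rewrite /continuous_at /g /= mulg1 subrr.
by move=> /cvgr0Pnorm_le /(_ e e0).
Qed.

Variable K : set H.
Hypotheses (hH : hausdorff_space H) (tdH : totally_disconnected [set: H]).
Hypothesis coK : compact_open_subgroup K.

Let small (V : set H) : set (set H) :=
  [set U | [/\ compact_open_subgroup U, U `<=` K & U `<=` V]].

Let small_filter : ProperFilter (filter_from (nbhs (1%g : H)) small).
Proof.
apply: filter_from_proper; last first.
  by move=> V V1; have [U ?] := van_dantzig hH tdH coK V1; exists U.
apply: filter_from_filter; first by exists setT; exact: filterT.
move=> V W V1 W1; exists (V `&` W); first exact: filterI.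
by move=> U [coU UK UVW]; split; split=> // x /UVW[].
Qed.

(** Invariance is only approximate at each stage U, with an error controlled by
    the oscillation of f along the cosets of U; this tends to 0 as U shrinks, by
    uniform continuity on K.  An ultrafilter makes all the averages converge at
    once, compatibly with linear combinations.  The mean depends only on the
    values on K, which is why translations by K alone are considered. *)
Lemma compact_invariant_mean : exists A : (H -> R) -> R,
  [/\ forall (a : R) f g, bounded_continuous f -> bounded_continuous g ->
        A (fun x => a * f x + g x) = a * A f + A g,
      forall f, bounded_continuous f -> (forall x, 0 <= f x) -> 0 <= A f,
      A (fun=> 1) = 1 &
      forall k f, K k -> bounded_continuous f ->
        A (fun x => f (k * x)%g) = A f].
Proof.
have [F [FU smallF]] := ultraFilterLemma small_filter.
have PF : ProperFilter F by exact: ultra_proper.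
have FK V : nbhs (1%g : H) V -> F (small V) by move=> V1; apply: smallF; exists V.
have FKT : F (small setT) by apply: FK; exact: filterT.
have sUK U : small setT U -> [/\ subgroup U, open U & U `<=` K].
  by move=> [[]].
pose avg f U : R := coset_average K U f.
have avg_cvg f : bounded_continuous f -> cvg (avg f U @[U --> F]).
  move=> /bounded_continuousP[_ [M fM]].
  have FM : F (avg f @^-1` `[- M, M]).
    apply: (filterS _ FKT) => U /sUK[sU oU UK].
    by rewrite /= in_itv /= -ler_norml; exact: coset_average_le.
  have FfU := fmap_ultra (avg f) FU.
  have := @segment_compact R (- M) M; rewrite compact_ultra.
  by case/(_ (avg f @ F) FfU FM) => l [_ Fl]; apply/cvg_ex; exists l.
have avg_cst a : avg (fun=> a) U @[U --> F] --> a.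
  apply: cvg_near_cst; apply: (filterS _ FKT) => U /sUK[sU oU UK].
  exact: coset_average_cst.
exists (fun f => lim (avg f U @[U --> F])); split.
- move=> a f g bf bg; apply: cvg_lim => //.
  have h : (a * avg f U + avg g U) @[U --> F] -->
      a * lim (avg f U @[U --> F]) + lim (avg g U @[U --> F]).
    by apply: cvgD; [apply: cvgMl_tmp|]; exact: avg_cvg.
  apply: cvg_trans h; apply: near_eq_cvg.
  apply: (filterS _ FKT) => U /sUK[sU oU UK].
  by rewrite /avg coset_average_linear.
- move=> f bf f0; apply: limr_ge; first exact: avg_cvg.
  by apply: (filterS _ FKT) => U /sUK[sU oU UK]; exact: coset_average_ge0.
- by apply: cvg_lim => //; exact: avg_cst.
- move=> k f Kk bf; apply: cvg_lim => //.
  have h0 : (avg (fun x => f (k * x)%g) U - avg f U) @[U --> F] --> (0 : R).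
    apply/cvgr0Pnorm_le => e e0.
    have [fc _] := bf; have [_ cK _] := coK.
    apply: (filterS _ (FK _ (uniformly_continuous_compact cK fc e0))).
    move=> U [[sU cU oU] UK Ue]; apply: coset_average_shift => // x u Kx Uu.
    exact: (Ue u Uu x Kx).
  have h : (avg (fun x => f (k * x)%g) U - avg f U + avg f U) @[U --> F] -->
      0 + lim (avg f U @[U --> F]).
    by apply: cvgD h0 _; exact: avg_cvg.
  rewrite add0r in h; apply: cvg_trans h; apply: near_eq_cvg.
  by apply: nearW => U /=; rewrite subrK.
Qed.

End InvariantMean.

Section Amenability.
Local Open Scope ring_scope.

(** The image L of K is a compact open subgroup of B; averaging f over the coset
    y L by a mean E on L gives a function of x, for S x y, which is constant on
    the cosets of K in A.  Pulling an invariant mean on A back along this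
    averaging operator F gives one on B. *)
Lemma amenable_corr (R : realType) (A B : topGroupType) (S : A -> B -> Prop)
    (K : set A) :
  proper_correspondence S -> hausdorff_space B ->
  totally_disconnected [set: B] -> compact_open_subgroup K ->
  amenable R A -> amenable R B.
Proof.
move=> pS hB tdB coK [m [m_lin m_ge0 m1 m_inv]].
have [E [E_lin E_ge0 E1 E_inv]] :=
  compact_invariant_mean R hB tdB (compact_open_subgroup_rel_image pS coK).
have [K1 KM KV] : subgroup K by case: coK.
have [t St] := choice (corr_total pS).
have bc_shift y (f : B -> R) : bounded_continuous f ->
    bounded_continuous (fun z => f (y * z)%g).
  move=> /bounded_continuousP[fc [M fM]]; apply/bounded_continuousP.
  split; last by exists M.
  move=> z; apply: (@continuous_comp _ _ _ (fun z => (y * z)%g) f).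
    exact: mulgl_continuous.
  exact: fc.
have bc_cst (a : R) : bounded_continuous (fun _ : B => a).
  by apply/bounded_continuousP; split; [move=> z; exact: cvg_cst|exists `|a|].
have bc_lin (a : R) (f g : B -> R) : bounded_continuous f ->
    bounded_continuous g -> bounded_continuous (fun z => a * f z + g z).
  move=> /bounded_continuousP[fc [M fM]] /bounded_continuousP[gc [N gN]].
  apply/bounded_continuousP; split.
    by move=> z; apply: cvgD; [apply: cvgMl_tmp; exact: fc|exact: gc].
  exists (`|a| * M + N) => z; apply: le_trans (ler_normD _ _) _.
  by rewrite normrM lerD// ler_wpM2l.
have E0 : E (fun=> 0) = 0.
  have := E_lin 1 (fun=> 0) (fun=> 0) (bc_cst 0) (bc_cst 0).
  by under [in LHS]eq_fun do rewrite mulr0 addr0; lra.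
have E_cst a : E (fun=> a) = a.
  have := E_lin a (fun=> 1) (fun=> 0) (bc_cst 1) (bc_cst 0).
  by under [in LHS]eq_fun do rewrite mulr1 addr0; rewrite E0 E1 mulr1 addr0.
pose F (f : B -> R) (x : A) : R := E (fun z => f (t x * z)%g).
(* F f x can be computed at any partner of any element of the coset x K *)
have FE f x y k : bounded_continuous f -> K k -> S (x * k)%g y ->
    F f x = E (fun z => f (y * z)%g).
  move=> bf Kk Sxy; rewrite /F -(E_inv ((t x)^-1 * y)%g (fun z => f (t x * z)%g)).
  - by congr E; apply/funext => z; rewrite !mulgA mulgV mul1g.
  - exists k => //; have := corrM pS (corrV pS (St x)) Sxy.
    by rewrite mulgA mulVg mul1g.
  - exact: bc_shift.
have bc_F f : bounded_continuous f -> bounded_continuous (F f).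
  move=> bf; apply/bounded_continuousP; split.
    move=> x; apply: cvg_near_cst.
    have : nbhs x (lcoset x K) by apply: nbhs_lcoset => //; case: coK.
    apply: filterS => x' Kx'; rewrite [RHS](FE f x (t x') (x^-1 * x')%g)//.
    by rewrite mulgA mulgV mul1g.
  have /bounded_continuousP[_ [M fM]] := bf.
  exists M => x; have bfx := bc_shift (t x) f bf.
  rewrite /F ler_norml; apply/andP; split.
    have : 0 <= E (fun z => 1 * f (t x * z)%g + M).
      apply: E_ge0 => [|z]; first by apply: bc_lin => //; exact: bc_cst.
      by have := fM (t x * z)%g; rewrite ler_norml => /andP[]; lra.
    by rewrite E_lin// E_cst; lra.
  have : 0 <= E (fun z => -1 * f (t x * z)%g + M).
    apply: E_ge0 => [|z].
      by apply: bc_lin.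
    by have := fM (t x * z)%g; rewrite ler_norml => /andP[]; lra.
  by rewrite E_lin// E_cst; lra.
exists (fun f => m (F f)); split.
- move=> a f g bf bg.
  rewrite -m_lin; [|exact: bc_F|exact: bc_F].
  congr m; apply/funext => x; rewrite /F E_lin//; exact: bc_shift.
- move=> f bf f0; apply: m_ge0; first exact: bc_F.
  by move=> x; apply: E_ge0 => //; exact: bc_shift.
- by rewrite -[RHS]m1; congr m; apply/funext => x; rewrite /F E1.
- move=> h f bf; have [x0 Sx0h] := corr_surj pS h.
  rewrite -(m_inv x0 (F f)); last exact: bc_F.
  congr m; apply/funext => x.
  rewrite (FE f (x0^-1 * x)%g (h^-1 * t x)%g 1%g)//.
    by rewrite /F; congr E; apply/funext => z; rewrite !mulgA.
  by rewrite mulg1; apply: (corrM pS); [exact: corrV|].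
Qed.

End Amenability.

(** * Two completions of the same size *)

Definition joint_closure (G H1 H2 : topGroupType) (phi : G -> H1) (psi : G -> H2)
  (x : H1) (y : H2) : Prop := closure (range (fun g => (phi g, psi g))) (x, y).

Section JointClosure.
Variables (G H1 H2 : topGroupType) (phi : G -> H1) (psi : G -> H2).
Hypotheses (phiM : {morph phi : x y / x * y}) (psiM : {morph psi : x y / x * y}).
Local Notation S := (joint_closure phi psi).

Lemma joint_closureP x y : S x y <->
  forall U V, nbhs x U -> nbhs y V -> exists2 g, U (phi g) & V (psi g).
Proof.
split=> [Sxy U V xU yV|h W [[U V] /= [xU yV] UV]].
  have [|_ [[g _ <-] [/= Ug Vg]]] := Sxy (U `*` V); first by exists (U, V).
  by exists g.
have [g Ug Vg] := h U V xU yV.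
by exists (phi g, psi g); split; [exists g|exact: UV].
Qed.

Lemma joint_closure_range g : S (phi g) (psi g).
Proof. by apply: subset_closure; exists g. Qed.

Lemma joint_closureM x x' y y' : S x y -> S x' y' -> S (x * x') (y * y').
Proof.
move=> /joint_closureP Sxy /joint_closureP Sxy'; apply/joint_closureP => U V.
move=> /(mulg_continuous (x, x'))[[U1 U2] /= [xU1 xU2] UU].
move=> /(mulg_continuous (y, y'))[[V1 V2] /= [yV1 yV2] VV].
have [g Ug Vg] := Sxy _ _ xU1 yV1; have [g' Ug' Vg'] := Sxy' _ _ xU2 yV2.
exists (g * g'); rewrite ?phiM ?psiM; first exact: (UU (_, _)).
exact: (VV (_, _)).
Qed.

Lemma joint_closureV x y : S x y -> S x^-1 y^-1.
Proof.
move=> /joint_closureP Sxy; apply/joint_closureP => U V.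
move=> /(invg_continuous x) xU /(invg_continuous y) yV.
by have [g Ug Vg] := Sxy _ _ xU yV; exists g^-1; rewrite morphV.
Qed.

Hypotheses (phi_dense : dense (range phi)) (psi_dense : dense (range psi)).
Hypothesis hausdorff2 : hausdorff_space H2.
Variables (R1 : set H1) (R2 : set H2).
Hypotheses (coR1 : compact_open_subgroup R1) (coR2 : compact_open_subgroup R2).
Hypothesis comm12 : commensurate (phi @^-1` R1) (psi @^-1` R2).

Let sR1 : subgroup R1. Proof. by case: coR1. Qed.
Let cR1 : compact R1. Proof. by case: coR1. Qed.
Let oR1 : open R1. Proof. by case: coR1. Qed.
Let sR2 : subgroup R2. Proof. by case: coR2. Qed.
Let cR2 : compact R2. Proof. by case: coR2. Qed.
Let oR2 : open R2. Proof. by case: coR2. Qed.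
Let R11 : R1 1. Proof. by case: sR1. Qed.
Let R1M x y : R1 x -> R1 y -> R1 (x * y). Proof. by case: sR1 => _ + _; exact. Qed.
Let R1V x : R1 x -> R1 x^-1. Proof. by case: sR1 => _ _; exact. Qed.
Let R21 : R2 1. Proof. by case: sR2. Qed.
Let R2M x y : R2 x -> R2 y -> R2 (x * y). Proof. by case: sR2 => _ + _; exact. Qed.
Let R2V x : R2 x -> R2 x^-1. Proof. by case: sR2 => _ _; exact. Qed.

Lemma joint_closure1 : S 1 1.
Proof. by rewrite -{1}(morph1 phiM) -(morph1 psiM); exact: joint_closure_range. Qed.

(** Let (x, y) be in S with x in R1, and approximate it by (phi g, psi g) with
    phi g in R1 and psi g in y R2.  Then g lies in one of finitely many cosets
    d W of the intersection W of the preimages of R1 and R2, so y lies in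
    psi d R2. *)
Lemma joint_image_bounded : exists2 L, compact L & rel_image S R1 `<=` L.
Proof.
have [|D fD DV] := finite_index_cover _ comm12.1.
  by split; rewrite /= morph1.
exists (\bigcup_(d in D) lcoset (psi d) R2).
  by apply: compact_bigcup_finite => // d _; exact: compact_lcoset.
move=> y [x R1x /joint_closureP Sxy].
have [| |g R1g R2g] := Sxy R1 (lcoset y R2).
- exact: open_nbhs_nbhs.
- exact: nbhs_lcoset.
have [d Dd [_ /= R2d]] := DV g R1g; exists d => //; rewrite /lcoset /=.
have -> : (psi d)^-1 * y = psi (d^-1 * g) * (y^-1 * psi g)^-1.
  by rewrite psiM (morphV psiM) invgM invgK mulgA mulgK.
exact: R2M R2d (R2V R2g).
Qed.

(** Finitely many cosets phi g R1 cover K, so the image of K lies in a compact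
    set L; it is then the projection of the part of the closed set S inside
    K * L. *)
Lemma joint_image_compact K : compact K -> compact (rel_image S K).
Proof.
move=> cK; have [L1 cL1 R1L1] := joint_image_bounded.
have [| |s KD] := @compact_finite_subcover _ G K (fun g => lcoset (phi g) R1) cK.
- by move=> g; exact: open_lcoset.
- move=> x _; have [|g xg] := dense_nbhs (x := x) (U := lcoset x R1) phi_dense.
    exact: nbhs_lcoset.
  by exists g; have := R1V xg; rewrite invgM invgK.
pose L := \bigcup_(g in [set` s]) lcoset (psi g) L1.
have cL : compact L.
  apply: compact_bigcup_finite; first exact: finite_seq.
  by move=> g _; exact: compact_lcoset.
have -> : rel_image S K = snd @` (K `*` L `&` closure (range (fun g => (phi g, psi g)))).
  apply/seteqP; split=> [y [x Kx Sxy]|_ [[x y] [[Kx _] Sxy] <-]]; last by exists x.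
  exists (x, y) => //; split=> //; split=> //=.
  have [g Dg R1gx] := KD _ Kx; exists g => //; apply: R1L1.
  exists ((phi g)^-1 * x) => //; apply: joint_closureM Sxy.
  by apply: joint_closureV; exact: joint_closure_range.
apply: continuous_compact.
  by apply: continuous_subspaceT => -[x y]; exact: cvg_snd.
by apply: compact_closedI; [exact: compact_setX|exact: closed_closure].
Qed.

Let D0 := rel_image S R1.

Let D0_subgroup : subgroup D0.
Proof.
split=> [|y y' [x R1x Sx] [x' R1x' Sx']|y [x R1x Sx]].
- by exists 1 => //; exact: joint_closure1.
- by exists (x * x'); [exact: R1M|exact: joint_closureM].
- by exists x^-1; [exact: R1V|exact: joint_closureV].
Qed.

Let D0_closed : closed D0.
Proof. by apply: (compact_closed hausdorff2); exact: joint_image_compact. Qed.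

(** Finitely many cosets of the closed subgroup D0 cover R2: they cover a dense
    part of it, and their union is closed.  Removing from R2 the cosets other
    than D0 leaves an open neighbourhood of 1 contained in D0. *)
Lemma joint_image_open : open D0.
Proof.
have [|D fD DV] := finite_index_cover _ comm12.2.
  by split; rewrite /= morph1.
have R2D : R2 `<=` \bigcup_(d in D) lcoset (psi d) D0.
  move=> y R2y; apply: contrapT => yD.
  have [|g [R2g gD]] := dense_nbhs (x := y)
      (U := R2 `&` ~` \bigcup_(d in D) lcoset (psi d) D0) psi_dense.
    apply: open_nbhs_nbhs; split=> //; apply: openI => //.
    by apply: closed_openC; apply: closed_bigcup => // d _; exact: closed_lcoset.
  apply: gD; have [d Dd [/= R1dg _]] := DV g R2g; exists d => //.
  exists (phi (d^-1 * g)) => //.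
  by rewrite -(morphV psiM) -psiM; exact: joint_closure_range.
pose D' := [set d | D d /\ ~ D0 (psi d)].
pose O := R2 `&` ~` \bigcup_(d in D') lcoset (psi d) D0.
apply: (@subgroup_open _ _ O) => //.
  apply: open_nbhs_nbhs; split.
    apply: openI => //; apply: closed_openC; apply: closed_bigcup.
      by apply: sub_finite_set fD => d [].
    by move=> d _; exact: closed_lcoset.
  split=> // -[d [Dd nD0d]]; rewrite /lcoset /= mulg1 => D0Vd; apply: nD0d.
  by rewrite -[psi d]invgK; case: D0_subgroup => _ _; exact.
move=> y [R2y yD']; have [d Dd D0y] := R2D y R2y.
have [D0d|nD0d] := pselect (D0 (psi d)); last by case: yD'; exists d.
case: D0_subgroup => _ D0M _; have := D0M _ _ D0d D0y.
by rewrite mulgA mulgV mul1g.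
Qed.

(** The coset y D0 is open, so it contains some psi g; if x in R1 is a partner
    of y^-1 (psi g), then phi g x^-1 is a partner of y. *)
Lemma joint_closure_surj y : exists x, S x y.
Proof.
have [|g [x R1x Sx]] := dense_nbhs (x := y) (U := lcoset y D0) psi_dense.
  by apply: nbhs_lcoset; [exact: joint_image_open|case: D0_subgroup].
exists (phi g * x^-1); have := joint_closureM (@joint_closure_range g) (joint_closureV Sx).
by rewrite invgM invgK mulgA mulgV mul1g.
Qed.

(** Open mapping by compactness.  Let V be the saturation of U under right
    translation by {k | S k 1}.  The part of x R1 outside V is compact, and
    its image is a closed set that misses y, since any partner of y is in
    x {k | S k 1}.  Near y every point is in y D0, thus has a partner in x R1,
    which must lie in V, and can be corrected to lie in U. *)
Lemma joint_closure_open U : open U -> open (rel_image S U).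
Proof.
move=> oU; rewrite openE => y [x Ux Sxy].
pose V := \bigcup_(k in [set k | S k 1]) ((fun z : H1 => z * k^-1) @^-1` U).
have oV : open V.
  apply: bigcup_open => k _; apply: open_comp => // z _; exact: mulgr_continuous.
have cC : compact (lcoset x R1 `&` ~` V).
  by apply: compact_closedI; [exact: compact_lcoset|exact: open_closedC].
have nbD0 : nbhs y (lcoset y D0).
  by apply: nbhs_lcoset; [exact: joint_image_open|case: D0_subgroup].
have nbC : nbhs y (~` rel_image S (lcoset x R1 `&` ~` V)).
  apply: open_nbhs_nbhs; split.
    apply: closed_openC; apply: (compact_closed hausdorff2).
    exact: joint_image_compact.
  case=> z [_ nVz] Szy; apply: nVz; exists (x^-1 * z).
    by rewrite /= -(mulVg y); apply: joint_closureM => //; exact: joint_closureV.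
  by rewrite /= invgM invgK mulgA mulgV mul1g.
apply: filterS (filterI nbD0 nbC) => y' [[r R1r Sr] y'C].
have Sxr : S (x * r) y'.
  by have := joint_closureM Sxy Sr; rewrite mulgA mulgV mul1g.
have : V (x * r).
  apply: contrapT => nV; apply: y'C; exists (x * r) => //; split=> //.
  by rewrite /lcoset /= mulgA mulVg mul1g.
case=> k Sk1 Uk; exists (x * r * k^-1) => //.
by rewrite -[y']mulg1 -invg1; apply: joint_closureM => //; exact: joint_closureV.
Qed.

End JointClosure.

Lemma joint_closureC (G H1 H2 : topGroupType) (phi : G -> H1) (psi : G -> H2) :
  (fun y x => joint_closure phi psi x y) = joint_closure psi phi.
Proof.
apply/funext => y; apply/funext => x; apply/propext.
by split=> /joint_closureP h; apply/joint_closureP => U V yU xV;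
   have [g Ug Vg] := h V U xV yU; exists g.
Qed.

Lemma joint_closure_proper (G H1 H2 : topGroupType) (phi : G -> H1)
    (psi : G -> H2) (R1 : set H1) (R2 : set H2) :
  completion_map phi -> completion_map psi ->
  compact_open_subgroup R1 -> compact_open_subgroup R2 ->
  commensurate (phi @^-1` R1) (psi @^-1` R2) ->
  proper_correspondence (joint_closure phi psi).
Proof.
move=> [[hH1 _ _] phiM _ phid] [[hH2 _ _] psiM _ psid] coR1 coR2 comm12.
have comm21 : commensurate (psi @^-1` R2) (phi @^-1` R1).
  by case: comm12 => ? ?; rewrite /commensurate setIC.
split.
- exact: joint_closureM.
- exact: joint_closureV.
- move=> x; rewrite -[joint_closure phi psi]/(fun x y => joint_closure phi psi x y).
  have [y] := joint_closure_surj psiM phiM psid phid hH1 coR2 coR1 comm21 x.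
  by rewrite -joint_closureC; exists y.
- exact: joint_closure_surj comm12.
- exact: joint_image_compact comm12.
- exact: joint_closure_open comm12.
Qed.

(** Equality of the sizes says in particular that the preimage of R2 belongs to
    the class of the preimage of R1, hence that the two are commensurate. *)
Lemma completions_correspondence (G : topGroupType) (alpha : set (set G))
    (H1 H2 : topGroupType) :
  tdlc_completion_of_size alpha H1 -> tdlc_completion_of_size alpha H2 ->
  exists S : H1 -> H2 -> Prop,
    proper_correspondence S /\ proper_correspondence (fun y x => S x y).
Proof.
move=> [phi cphi [R1 coR1 alpha1]] [psi cpsi [R2 coR2 alpha2]].
have comm12 : commensurate (phi @^-1` R1) (psi @^-1` R2).
  have sW : subgroup (psi @^-1` R2).
    case: cpsi coR2 => _ psiM _ _ [[R21 R2M R2V] _ _]; split=> /=.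
    - by rewrite morph1.
    - by move=> x y R2x R2y; rewrite psiM; exact: R2M.
    - by move=> x R2x; rewrite morphV//; exact: R2V.
  suff : alpha (psi @^-1` R2) by rewrite alpha1 => -[].
  rewrite alpha2; split=> //; last exact: commensurate_refl.
  case: cpsi coR2 => _ _ psic _ [sR2 _ oR2].
  by apply: closed_comp => [x _|]; [exact: psic|exact: open_subgroup_closed].
exists (joint_closure phi psi); split; first exact: joint_closure_proper comm12.
rewrite joint_closureC; apply: joint_closure_proper coR2 coR1 _ => //.
by case: comm12 => ? ?; rewrite /commensurate setIC.
Qed.

Lemma determined_by_size_transfer (G : topGroupType) (alpha : set (set G))
    (P : topGroupType -> Prop) :
  (forall H1 H2, tdlc_completion_of_size alpha H1 ->
     tdlc_completion_of_size alpha H2 -> P H1 -> P H2) ->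
  determined_by_size alpha P.
Proof.
move=> PP; have [[H1 [aH1 PH1]]|nP] :=
    pselect (exists H1, tdlc_completion_of_size alpha H1 /\ P H1).
  by left=> H2 aH2; exact: PP PH1.
by right=> H aH PH; apply: nP; exists H.
Qed.

Theorem theorem1p5 (R : realType) (G : topGroupType) (hG : hausdorff_space G)
    (alpha : set (set G)) (halpha : is_size alpha) :
  [/\ determined_by_size alpha sigma_compact,
      determined_by_size alpha compactly_generated,
      determined_by_size alpha (amenable R),
      determined_by_size alpha uniscalar &
      forall N : topGroupType, tdlc N ->
        no_nontrivial_compact_normal_subgroup N ->
        determined_by_size alpha (has_quotient_isomorphic_to N)].
Proof.
split; last move=> N [hN _ _] nN.
all: apply: determined_by_size_transfer => H1 H2 aH1 aH2.
all: have [S [pS pS']] := completions_correspondence aH1 aH2.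
- exact: sigma_compact_corr pS.
- exact: compactly_generated_corr pS.
- have [phi _ [K coK _]] := aH1; have [psi [[hH2 tdH2 _] _ _ _] _] := aH2.
  exact: amenable_corr pS hH2 tdH2 coK.
- exact: uniscalar_corr pS.
- exact: quotient_corr pS pS' hN nN.
Qed.
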